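(* If $Q(0)=0$ and $Q_n(0)=0$ for all $n\in\mathcal N$, then the virtualization technique stabilizes the actual queue $Q(t)$ with the bound $$Q(t)\le N(Vc_{\max}+R_{\max})\qquad\text{for all }t\in\{0,1,2,\dots\},$$ where $c_{\max}=\max_{c\in\mathcal C}c$.
   Context: Slotted time $t=0,1,2,\dots$; servers $\mathcal N=\{1,\dots,N\}$. On slot $t$, $\lambda(t)$ requests arrive ($\lambda(t)$ a nonnegative integer) and the per-request rejection cost is $c(t)$, with values in a finite set $\mathcal C$ of nonnegative numbers. $H_n(t)\in\{0,1\}$ indicates that server $n$ is active on slot $t$ and $\mu_n(t)\ge0$ is the number of requests it can serve. $V>0$ and $R_{\max}$ (a positive integer) are parameters. **Virtualization technique.** Virtual queues (kept in software) evolve as $Q_n(t+1)=\max\{Q_n(t)+R_n(t)-\mu_n(t)H_n(t),0\}$, $n\in\mathcal N$. Each slot $t$: if some $n$ has $Q_n(t)\le Vc(t)$, then $r(t)=\max\{\lambda(t)-R_{\max},0\}$ requests are rejected, and $R_n(t)=\min\{\lambda(t),R_{\max}\}$ for a single shortest virtual queue $n$ (ties broken arbitrarily) while $R_n(t)=0$ for the others; otherwise $r(t)=\lambda(t)$ and $R_n(t)=0$ for all $n$. Each server makes its active/sleep decisions based on its own virtual queue $Q_n$ only. All admitted requests are placed in one actual queue $Q(t)$, from which active servers take requests, so that $$Q(t+1)=\max\Big\{Q(t)+\lambda(t)-r(t)-\sum_{n=1}^N\mu_n(t)H_n(t),\,0\Big\},$$ with the same $\lambda(t),r(t),H_n(t),\mu_n(t)$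 as in the virtual system. *)

(* Defs.v *)
From mathcomp Require Import all_boot all_order all_algebra finmap.
Set Implicit Arguments.
Unset Strict Implicit.
Unset Printing Implicit Defensive.
Import Order.TTheory GRing.Theory Num.Theory.
Local Open Scope ring_scope.

(* The base value 0 of the iterated maximum is harmless for a nonempty set of
   nonnegative costs; see cmaxP. *)
Definition cmax (R : realFieldType) (C : {fset R}) : R :=
  \big[Order.max/0]_(x <- enum_fset C) x.

Lemma cmaxP (R : realFieldType) (C : {fset R}) (c0 : R) :
  c0 \in C -> (forall x, x \in C -> 0 <= x) ->
  cmax C \in C /\ (forall x, x \in C -> x <= cmax C).
Proof.
move=> c0C C_ge0.
have max_ge (s : seq R) x : x \in s -> x <= \big[Order.max/0]_(y <- s) y.
  elim: s => // a s IH; rewrite big_cons inE le_max => /orP[/eqP ->|/IH ->].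
    by rewrite lexx.
  by rewrite orbT.
have max_mem (s : seq R) : \big[Order.max/0]_(y <- s) y \in 0 :: s.
  elim: s => [|a s IH]; first by rewrite big_nil mem_head.
  rewrite big_cons; case: leP => _; last by rewrite !inE eqxx orbT.
  by move: IH; rewrite !inE => /orP[->//|->]; rewrite !orbT.
split=> [|x]; last exact: max_ge.
have := max_mem (enum_fset C); rewrite inE => /orP[/eqP max0|//].
rewrite /cmax max0; have := max_ge _ _ c0C; rewrite max0 => c0_le0.
by have <- : c0 = 0 by apply/le_anti; rewrite c0_le0 C_ge0.
Qed.

(* The admission and routing rule on one slot, for arrivals lam, rejection
   cost c and virtual backlogs Q n, producing r rejections and A n requests
   placed in virtual queue n.  The truncated subtraction lam - Rmax is
   max{lam - Rmax, 0}.  The rule is a relation because the shortest queue need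
   not be unique. *)
Definition admission (R : realFieldType) (N : nat) (V : R) (Rmax : nat)
    (lam : nat) (c : R) (Q : 'I_N -> R) (r : nat) (A : 'I_N -> nat) : Prop :=
  if [exists n, Q n <= V * c] then
    r = (lam - Rmax)%N /\
    exists n : 'I_N, (forall m, Q n <= Q m) /\
      forall m, A m = if m == n then minn lam Rmax else 0%N
  else r = lam /\ forall n, A n = 0%N.

(* A sample path of the virtualization technique: Qv n t is the virtual queue
   of server n, Q t the actual queue.  The activity of server n on slot t is
   given by an arbitrary policy pi n applied to the slot and to the history
   Qv n 0, ..., Qv n t of its own virtual queue; since pi depends on the sample
   path, the policy may also be randomized. *)
Record virtualization (R : realFieldType) (N : nat) (V : R) (Rmax : nat)
    (lam : nat -> nat) (c : nat -> R) (mu : 'I_N -> nat -> R)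
    (pi : 'I_N -> nat -> seq R -> bool) (H : 'I_N -> nat -> bool)
    (r : nat -> nat) (A : 'I_N -> nat -> nat)
    (Qv : 'I_N -> nat -> R) (Q : nat -> R) : Prop := Virtualization {
  virt_admission : forall t,
    admission V Rmax (lam t) (c t) (fun n => Qv n t) (r t) (fun n => A n t);
  virt_activity : forall n t, H n t = pi n t [seq Qv n s | s <- iota 0 t.+1];
  virt_queue : forall n t,
    Qv n t.+1 = Num.max (Qv n t + (A n t)%:R - mu n t * (H n t)%:R) 0;
  virt_actual : forall t,
    Q t.+1 = Num.max
      (Q t + (lam t)%:R - (r t)%:R - \sum_(n < N) mu n t * (H n t)%:R) 0
}.

(* Main.v *)
(* Both queues receive the same admitted requests and the same offered service,
   but an idle virtual server cannot help the others, so the actual backlog is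
   at most the sum of the virtual ones.  A virtual queue only grows when its
   backlog is at most V c, and then by at most Rmax, so each one stays below
   V cmax + Rmax. *)

Require Import Defs.
From mathcomp Require Import all_boot all_order all_algebra finmap.
Set Implicit Arguments.
Unset Strict Implicit.
Unset Printing Implicit Defensive.
Import Order.TTheory GRing.Theory Num.Theory.
Local Open Scope ring_scope.

(** This couples the two systems: the requests entering the actual queue are exactly those spread
    over the virtual ones. *)
Lemma admission_conservation (R : realFieldType) (N : nat) (V : R)
    (Rmax lam : nat) (c : R) (Q : 'I_N -> R) (r : nat) (A : 'I_N -> nat) :
  admission V Rmax lam c Q r A -> lam = (r + \sum_(n < N) A n)%N.
Proof.
rewrite /admission; case: ifP => _ [->]; last first.
  by move=> A0; rewrite big1 ?addn0.
case=> n [_ AE]; rewrite (bigD1 n) //= AE eqxx big1 => [|m /negPf mn].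
  by rewrite addn0 minnE subnKC // leq_subr.
by rewrite AE mn.
Qed.

Lemma admission_backlog (R : realFieldType) (N : nat) (V : R)
    (Rmax lam : nat) (c b : R) (Q : 'I_N -> R) (r : nat) (A : 'I_N -> nat) :
  admission V Rmax lam c Q r A -> V * c <= b ->
  forall n, Q n <= b + Rmax%:R -> Q n + (A n)%:R <= b + Rmax%:R.
Proof.
rewrite /admission => adm Vcb n Qn; move: adm.
case: ifP => [/existsP[k Qk] [_ [m [Qmin AE]]]|_ [_ ->]]; last by rewrite addr0.
rewrite AE; case: eqP => [->|_]; last by rewrite addr0.
apply: lerD; last by rewrite ler_nat geq_minr.
(* The test only yields some [k] with backlog at most [V * c]; the shortest queue [m] inherits this
   bound. *)
exact: le_trans (Qmin k) (le_trans Qk Vcb).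
Qed.

Theorem lemma3p4p1 (R : realFieldType) (N : nat) (V : R) (Rmax : nat)
    (C : {fset R}) (lam : nat -> nat) (c : nat -> R) (mu : 'I_N -> nat -> R)
    (pi : 'I_N -> nat -> seq R -> bool) (H : 'I_N -> nat -> bool)
    (r : nat -> nat) (A : 'I_N -> nat -> nat)
    (Qv : 'I_N -> nat -> R) (Q : nat -> R)
    (V_gt0 : 0 < V) (Rmax_gt0 : (0 < Rmax)%N)
    (C_ge0 : forall x, x \in C -> 0 <= x)
    (c_in : forall t, c t \in C)
    (mu_ge0 : forall n t, 0 <= mu n t)
    (virt : virtualization V Rmax lam c mu pi H r A Qv Q)
    (Q0 : Q 0%N = 0) (Qv0 : forall n, Qv n 0%N = 0) :
  forall t : nat, Q t <= N%:R * (V * cmax C + Rmax%:R).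
Proof.
have b_ge0 : 0 <= V * cmax C.
  (* The cost [c 0] witnesses that [C] is nonempty, so [cmax C] is a genuine member of [C]. *)
  by have [/C_ge0 cm_ge0 _] := cmaxP (c_in 0%N) C_ge0; rewrite mulr_ge0 // ltW.
have serv_ge0 n t : 0 <= mu n t * (H n t)%:R by rewrite mulr_ge0.
have Qv_le n t : Qv n t <= V * cmax C + Rmax%:R.
  elim: t => [|t IH]; first by rewrite Qv0 addr_ge0.
  rewrite (virt_queue virt) ge_max addr_ge0 // andbT.
  have Vc : V * c t <= V * cmax C.
    by rewrite ler_pM2l //; have [_ ->] := cmaxP (c_in 0%N) C_ge0.
  (* Service only lowers the backlog, so it is dropped here. *)
  apply: le_trans (admission_backlog (virt_admission virt t) Vc IH).
  by rewrite gerBl.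
have Q_le t : Q t <= \sum_(n < N) Qv n t.
  elim: t => [|t IH]; first by rewrite Q0 big1.
  rewrite (virt_actual virt) ge_max; apply/andP; split; last first.
    by apply: sumr_ge0 => n _; rewrite (virt_queue virt) le_max lexx orbT.
  (* Splitting [lam t] into rejections and placements makes [r t] cancel. *)
  rewrite {1}(admission_conservation (virt_admission virt t)).
  rewrite natrD natr_sum addrA addrAC addrK.
  (* The intermediate sum is that of the virtual updates before truncation; truncating each term at
     0 can only increase it. *)
  apply: (@le_trans _ _
    (\sum_(n < N) (Qv n t + (A n t)%:R - mu n t * (H n t)%:R))).
    by rewrite sumrB big_split /= !lerD.
  by apply: ler_sum => n _; rewrite (virt_queue virt) le_max lexx.
move=> t; apply: le_trans (Q_le t) _.
rewrite mulr_natl -[N in _ *+ N]card_ord -sumr_const.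
exact: ler_sum.
Qed.
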